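(* Let $X$ be a compact Hausdorff space with a $\mathbb{P}$-diagonal. Then $X$ is metrizable.
   Context: $\mathbb{P}$ denotes the set $\omega^\omega$ of all functions $f:\omega\to\omega$, with the product topology ($\omega$ discrete), so $\mathbb{P}$ is homeomorphic to the space of irrational numbers. It is ordered coordinatewise: $f\le g$ means $f(n)\le g(n)$ for all $n\in\omega$. A space $Z$ is $\mathbb{P}$-dominated if there is a cover $\{C_K : K \text{ a compact subset of } \mathbb{P}\}$ of $Z$ by compact subsets of $Z$ such that $K\subseteq L$ implies $C_K\subseteq C_L$. Equivalently, there is a family $\langle K_f : f\in\mathbb{P}\rangle$ of compact subsets of $Z$ with $\bigcup_{f\in\mathbb{P}}K_f=Z$ such that $f\le g$ implies $K_f\subseteq K_g$ (an order-preserving cover by compact sets). A space $X$ has a $\mathbb{P}$-diagonal if the subspace $X^2\setminus\Delta$ of $X^2$ is $\mathbb{P}$-dominated, where $\Delta=\{(x,x):x\in X\}$ is the diagonal. *)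

(* Defs.v *)
From HB Require Import structures.
From mathcomp Require Import all_boot all_order all_algebra.
From mathcomp Require Import all_classical all_reals topology.

Set Implicit Arguments.
Unset Strict Implicit.
Unset Printing Implicit Defensive.

Local Open Scope classical_set_scope.

Definition baire : topologicalType := prod_topology (fun _ : nat => nat).

(* Only the values of C at compact subsets of the Baire space matter. *)
Definition P_dominated (Z : topologicalType) : Prop :=
  exists C : set baire -> set Z,
    [/\ forall K, compact K -> compact (C K),
        \bigcup_(K in [set K | compact K]) C K = [set: Z]
      & forall K L, compact K -> compact L -> K `<=` L -> C K `<=` C L].

(* The subtype [set_type A] carries the subspace topology; the library's
   [subspace A] does not (it is the whole space, discrete off A). *)
Definition P_diagonal (X : topologicalType) : Prop :=
  P_dominated (set_type (~` @diagonal X)).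

Definition metrizable (R : realType) (X : topologicalType) : Prop :=
  exists (M : metricType R) (f : X -> M) (g : M -> X),
    [/\ cancel f g, cancel g f, continuous f & continuous g].

(* Main.v *)
Require Import Defs.
From HB Require Import structures.
From mathcomp Require Import all_boot all_order all_algebra.
From mathcomp Require Import all_classical all_reals topology.
From mathcomp Require Import interval_inference normedtype lra.

(* Index the compact cover of the off-diagonal by f : nat -> nat (values of the
   original cover at the boxes {g | g <= f}), giving closed sets K_f of X^2, and
   let A_{f|n} be the union of the K_g with g|n = f|n. If a_k is in A_{f|k} for
   all k, then all a_k lie in one K_g; hence B_f, the intersection over n of the
   A_{f|n}, contains the closure of each of its countable subsets (it is
   omega-closed). Maximal filters of omega-closed sets in a compact space are
   closed under countable intersections.

   Every such filter F on X contains a singleton. Otherwise each y has some f_y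
   such that the section at y of each A_{f_y|n} meets all members of F, so that
   the section E_y of B_{f_y} at y belongs to F. For a suitable f, one can pick
   y_k in the intersection of the E_{y_i}, i < k, such that f_{y_k}|k = f|k; then
   all pairs (y_i, y_k), i < k, lie in a single K_g, and a cluster point p of the
   sequence gives (p, p) in K_g, which is absurd.

   If the closure of A_{f|n} met the diagonal for all n, the sets B_f /\ closure U,
   for U an open neighbourhood of the diagonal, would extend to a maximal filter
   of omega-closed sets of X^2 with no singleton, and one of its two projections
   would have no singleton either. So the off-diagonal is a countable union of
   closed sets, whence countably many continuous functions separate the points
   of X. *)

Set Implicit Arguments.
Unset Strict Implicit.
Unset Printing Implicit Defensive.

Import Order.TTheory GRing.Theory Num.Theory numFieldNormedType.Exports.

Local Open Scope classical_set_scope.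

(** * Cluster points and omega-closed sets *)

Lemma closed_preimage (T U : topologicalType) (f : T -> U) (A : set U) :
  continuous f -> closed A -> closed (f @^-1` A).
Proof. by move=> /continuous_closedP cf /cf. Qed.

Lemma closure_sub_closed (T : topologicalType) (A C : set T) :
  closed C -> A `<=` C -> closure A `<=` C.
Proof. by move=> /closure_id {2}-> /closureS. Qed.

Lemma sequence_cluster (T : topologicalType) (a : nat -> T) :
  compact [set: T] -> exists p, forall n, closure [set a (n + k)%N | k in setT] p.
Proof.
move=> cT; have [p [_ ap]] := cT (a @ \oo) _ filterT.
exists p => n B pB; apply: (ap _ _ _ pB).
by exists n => // k /= nk; exists (k - n)%N => //; rewrite subnKC.
Qed.

Definition omega_closed (T : topologicalType) (S : set T) :=
  forall a : nat -> T, (forall n, S (a n)) -> closure (range a) `<=` S.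

Lemma closed_omega_closed (T : topologicalType) (S : set T) :
  closed S -> omega_closed S.
Proof. by move=> cS a aS; apply: closure_sub_closed => // _ [n _ <-]. Qed.

Lemma omega_closedI (T : topologicalType) (S S' : set T) :
  omega_closed S -> omega_closed S' -> omega_closed (S `&` S').
Proof.
move=> oS oS' a aS p ap.
by split; [apply: (oS a) | apply: (oS' a)] => // n; have [] := aS n.
Qed.

Lemma omega_closed_bigcap (T : topologicalType) (I : Type) (S : I -> set T) :
  (forall i, omega_closed (S i)) -> omega_closed (\bigcap_i S i).
Proof. by move=> oS a aS p ap i _; apply: (oS i a) => // n; exact: aS. Qed.

Lemma omega_closed_preimage (T U : topologicalType) (f : T -> U) (S : set U) :
  continuous f -> omega_closed S -> omega_closed (f @^-1` S).
Proof.
move=> cf oS a aS p ap; apply: (oS (f \o a)) => // B fpB.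
have [_ [[n _ <-] anB]] := ap _ (cf p _ fpB).
by exists (f (a n)); split => //; exists n.
Qed.

(** The sequence lifts to [b] in [S]; the closure of the range of [b] is a compact part of [S], so
    its image is closed and contains the closure of the range of [a]. *)
Lemma omega_closed_image (T U : topologicalType) (f : T -> U) (S : set T) :
  compact [set: T] -> hausdorff_space U -> continuous f ->
  omega_closed S -> omega_closed (f @` S).
Proof.
move=> cT hU cf oS a aS.
have /choice[b bS] n : exists x, S x /\ f x = a n.
  by have [x Sx <-] := aS n; exists x.
have Sb : closure (range b) `<=` S by apply: oS => n; have [] := bS n.
apply: subset_trans (image_subset f Sb).
apply: closure_sub_closed.
  apply: compact_closed => //; apply: continuous_compact.
    exact: continuous_subspaceT.
  by apply: subclosed_compact cT _ => //; exact: closed_closure.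
move=> _ [n _ <-]; exists (b n); last by have [] := bS n.
by apply: subset_closure; exists n.
Qed.

Lemma omega_closed_cluster (T : topologicalType) (S : set T) (a : nat -> T) p n :
  omega_closed S -> (forall k, (n <= k)%N -> S (a k)) ->
  closure [set a (n + k)%N | k in setT] p -> S p.
Proof.
move=> oS aS; apply: (oS (fun k => a (n + k)%N)) => k.
by apply: aS; exact: leq_addr.
Qed.

(** * Cylinders and cores of an ordered family *)

Definition agree (n : nat) (g f : nat -> nat) := forall i, (i < n)%N -> g i = f i.

(* A_{f|n} *)
Definition cyl (T : Type) (K : (nat -> nat) -> set T) f n : set T :=
  [set p | exists2 g, agree n g f & K g p].

(* B_f *)
Definition core (T : Type) (K : (nat -> nat) -> set T) f : set T :=
  \bigcap_n cyl K f n.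

Definition ordered_closed (T : topologicalType) (K : (nat -> nat) -> set T) :=
  (forall f, closed (K f)) /\
  (forall f g, (forall n, (f n <= g n)%N) -> K f `<=` K g).

Lemma cyl_le (T : Type) (K : (nat -> nat) -> set T) f m n :
  (m <= n)%N -> cyl K f n `<=` cyl K f m.
Proof.
by move=> mn p [g gf Kp]; exists g => // i im; apply: gf; exact: leq_trans mn.
Qed.

(* Functions h_k with a_k in K_{h_k} and h_k|k = f|k have a common upper bound,
   because only finitely many of them differ from f at a given i. *)
Lemma closure_cyl (T : topologicalType) (K : (nat -> nat) -> set T) f m
    (a : nat -> T) :
  ordered_closed K -> (forall k, cyl K f (maxn m k) (a k)) ->
  closure (range a) `<=` cyl K f m.
Proof.
move=> [cK mK] aA.
have /choice[h hP] k : exists g, agree (maxn m k) g f /\ K g (a k).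
  by have [g] := aA k; exists g.
pose g i := if (i < m)%N then f i else (\sum_(k < i.+1) h k i + f i)%N.
move=> p ap; exists g; first by move=> i im; rewrite /g im.
suff : closure (range a) `<=` K g by exact.
apply: closure_sub_closed => // _ [k _ <-].
have [hf] := hP k; apply: mK => i; rewrite /g.
case: ltnP => im; first by rewrite hf// leq_max im.
have [ki|ik] := leqP k i; last by rewrite hf ?leq_max ?ik ?orbT// leq_addl.
rewrite (leq_trans _ (leq_addr _ _))//.
by rewrite (bigD1 (Ordinal (ki : k < i.+1)%N))//= leq_addr.
Qed.

Lemma core_omega_closed (T : topologicalType) (K : (nat -> nat) -> set T) f :
  ordered_closed K -> omega_closed (core K f).
Proof.
move=> oK a aB p ap m _.
by apply: (@closure_cyl _ K f m a) => // k; exact: aB.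
Qed.

(** Points chosen in [S] and in [cyl K f n], one for each [n], cluster at some [p] of [S];
    [closure_cyl], applied to the tail from [m] on, puts [p] in [cyl K f m]. *)
Lemma core_meets (T : topologicalType) (K : (nat -> nat) -> set T) f (S : set T) :
  compact [set: T] -> ordered_closed K -> omega_closed S ->
  (forall n, cyl K f n `&` S !=set0) -> core K f `&` S !=set0.
Proof.
move=> cT oK oS /choice[a aP].
have [p ap] := @sequence_cluster _ a cT.
exists p; split; last first.
  by apply: (omega_closed_cluster oS _ (ap 0)) => k _; have [] := aP k.
move=> m _; apply: (@closure_cyl _ K f m (fun k => a (m + k)%N)) => //.
move=> k; have [+ _] := aP (m + k)%N; apply: cyl_le.
by rewrite geq_max leq_addr leq_addl.
Qed.

(** * Maximal filters of omega-closed sets *)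

Definition max_omega_filter (T : topologicalType) (F : set (set T)) :=
  [/\ forall S, F S -> omega_closed S /\ S !=set0,
      forall S S', F S -> F S' -> F (S `&` S')
    & forall C, omega_closed C -> (forall S, F S -> C `&` S !=set0) -> F C].

(** Meant for sets that need not be omega-closed; an omega-closed positive set belongs to [F] when
    [F] is maximal. *)
Definition positive (T : Type) (F : set (set T)) (D : set T) :=
  forall S, F S -> D `&` S !=set0.

Lemma max_omega_filter_exists (T : topologicalType) (B : set (set T)) :
  B !=set0 ->
  (forall S, B S -> omega_closed S /\ S !=set0) ->
  (forall S S', B S -> B S' -> B (S `&` S')) ->
  exists F, B `<=` F /\ max_omega_filter F.
Proof.
move=> [S0 BS0] Bo BI.
(* The disjunct [F = set0] serves the empty chain, whose union must satisfy [P] too. *)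
pose P (F : set (set T)) := F = set0 \/
  [/\ B `<=` F, forall S, F S -> omega_closed S /\ S !=set0 &
      forall S S', F S -> F S' -> F (S `&` S')].
have [|F [PF maxF]] := @Zorn_bigcup _ P.
  move=> C CP Ctot.
  have [->|/set0P[S1 [F1 CF1 F1S1]]] := eqVneq (\bigcup_(X in C) X) set0.
    by left.
  have PC X S : C X -> X S -> [/\ B `<=` X,
      forall S, X S -> omega_closed S /\ S !=set0 &
      forall S S', X S -> X S' -> X (S `&` S')].
    by move=> /CP[->|//].
  right; split.
  - by have [BF1 _ _] := PC _ _ CF1 F1S1; move=> S /BF1 FS; exists F1.
  - by move=> S [X CX XS]; have [_ + _] := PC _ _ CX XS; apply.
  - move=> S S' [X CX XS] [Y CY YS'].
    have [XY|YX] := Ctot _ _ CX CY.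
      by exists Y => //; have [_ _] := PC _ _ CY YS'; apply => //; exact: XY.
    by exists X => //; have [_ _] := PC _ _ CX XS; apply => //; exact: YX.
have [BF Fo FI] : [/\ B `<=` F, forall S, F S -> omega_closed S /\ S !=set0 &
      forall S S', F S -> F S' -> F (S `&` S')].
  case: PF => // F0; exfalso; apply: (maxF B); last by right; split.
  by rewrite F0; split; [exact: sub0set | move=> /(_ _ BS0)].
exists F; split => //; split => // C oC CF.
apply: contrapT => nFC.
pose F' := [set G | omega_closed G /\ exists2 S, F S & C `&` S `<=` G].
apply: (maxF F').
  split; last first.
    by move=> F'F; apply/nFC/F'F; split => //; exists S0; [exact: BF|move=> ? []].
  by move=> S FS; split; [have [] := Fo _ FS|exists S => // ? []].
right; split.
- by move=> S BS; split; [have [] := Bo _ BS|exists S; [exact: BF|move=> ? []]].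
- by move=> S [oS [G FG GS]]; split => //; have [x /GS Sx] := CF _ FG; exists x.
- move=> S S' [oS [G FG GS]] [oS' [G' FG' GS']]; split; first exact: omega_closedI.
  exists (G `&` G'); first exact: FI.
  by move=> x [Cx [Gx G'x]]; split; [exact: GS|exact: GS'].
Qed.

Lemma max_omega_filterS (T : topologicalType) (F : set (set T)) (S C : set T) :
  max_omega_filter F -> F S -> omega_closed C -> S `<=` C -> F C.
Proof.
move=> [Fo FI Fm] FS oC SC; apply: Fm => // G FG.
have [x [Sx Gx]] := (Fo _ (FI _ _ FS FG)).2.
by exists x; split => //; exact: SC.
Qed.

Lemma max_omega_filterT (T : topologicalType) (F : set (set T)) :
  max_omega_filter F -> F setT.
Proof.
move=> [Fo _ Fm]; apply: Fm => [|S /Fo[_ [y]]]; last by exists y.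
by apply: closed_omega_closed; exact: closedT.
Qed.

(** By maximality it is enough to meet each member [G]: points of [G] and of [S 0], ..., [S n], one
    for each [n], have a cluster point, which lies in every [S n]. *)
Lemma max_omega_filter_bigcap (T : topologicalType) (F : set (set T))
    (S : nat -> set T) :
  compact [set: T] -> max_omega_filter F -> (forall n, F (S n)) ->
  F (\bigcap_n S n).
Proof.
move=> cT mF FS; have [Fo FI Fm] := mF.
have oS n : omega_closed (S n) by have [] := Fo _ (FS n).
apply: Fm => [|G FG]; first exact: omega_closed_bigcap.
have /choice[a aP] n : exists x, G x /\ forall i, (i <= n)%N -> S i x.
  suff [H FH HS] : exists2 H, F H & forall i, (i <= n)%N -> H `<=` S i.
    have [x [Hx Gx]] := (Fo _ (FI _ _ FH FG)).2.
    by exists x; split => // i /HS; exact.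
  elim: n => [|n [H FH HS]].
    by exists (S 0) => // i; rewrite leqn0 => /eqP ->.
  exists (H `&` S n.+1); first exact: FI.
  move=> i; rewrite leq_eqVlt => /predU1P[->|]; first exact: subIsetr.
  by rewrite ltnS => /HS HSi x [/HSi].
have [p ap] := @sequence_cluster _ a cT.
exists p; split; last first.
  by apply: (omega_closed_cluster (Fo _ FG).1 _ (ap 0)) => k _; have [] := aP k.
move=> n _; apply: (omega_closed_cluster (oS n) _ (ap n)) => k nk.
by have [_] := aP k; apply.
Qed.

(** Each non-positive [A s] is missed by a member [G s]. There are only countably many [s], so some
    [a] in [D] lies in all [G s]; if [R a f], then every [A (mkseq f n)] is positive. *)
Lemma positive_branch (T : topologicalType) (F : set (set T)) (D : set T)
    (R : T -> (nat -> nat) -> Prop) :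
  compact [set: T] -> max_omega_filter F -> positive F D ->
  (forall a, D a -> exists g, R a g) ->
  exists f, forall n,
    positive F [set a | D a /\ exists2 g, agree n g f & R a g].
Proof.
move=> cT mF pD DR.
pose A (s : seq nat) :=
  [set a | D a /\ exists2 g, mkseq g (size s) = s & R a g].
have /choice[G GP] s : exists G, F G /\ (~ positive F (A s) -> A s `&` G = set0).
  have [pA|npA] := pselect (positive F (A s)).
    by exists setT; split => //; exact: max_omega_filterT.
  have [G FG AG] : exists2 G, F G & A s `&` G = set0.
    apply: contrapT => nG; apply: npA => S FS; apply/set0P/eqP => AS.
    by apply: nG; exists S.
  by exists G.
pose S n := if unpickle n is Some s then G s else setT.
have FS : F (\bigcap_n S n).
  apply: max_omega_filter_bigcap => // n; rewrite /S.
  by case: unpickle => [s|]; [have [] := GP s|exact: max_omega_filterT].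
have [a [Da Sa]] := pD _ FS; have [f Raf] := DR _ Da.
exists f => n.
have Ga : G (mkseq f n) a.
  by have := Sa (pickle (mkseq f n)) I; rewrite /S pickleK.
have : positive F (A (mkseq f n)).
  apply: contrapT => /(GP (mkseq f n)).2 AG.
  suff : (A (mkseq f n) `&` G (mkseq f n)) a by rewrite AG.
  by split => //; split => //; exists f; rewrite ?size_mkseq.
move=> pA H /pA[b [[Db [g gf Rbg]] Hb]]; exists b; split => //; split => //.
exists g => // i ni; move: gf; rewrite size_mkseq => /(congr1 (fun s => nth 0 s i)).
by rewrite !nth_mkseq.
Qed.

Lemma max_omega_filter_core (T : topologicalType) (F : set (set T))
    (K : (nat -> nat) -> set T) f :
  compact [set: T] -> max_omega_filter F -> ordered_closed K ->
  (forall n, positive F (cyl K f n)) -> F (core K f).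
Proof.
move=> cT mF oK pK; have [Fo _ Fm] := mF.
apply: Fm => [|S FS]; first exact: core_omega_closed.
by apply: core_meets => // [|n]; [have [] := Fo _ FS|exact: pK].
Qed.

(** * Principality of maximal filters *)

Lemma ordered_closed_section (T : topologicalType)
    (K : (nat -> nat) -> set (T * T)) y :
  ordered_closed K -> ordered_closed (fun g => [set a | K g (y, a)]).
Proof.
move=> [cK mK]; split=> [f|f g fg a]; last exact: mK.
apply: (@closed_preimage _ _ (pair y)) => // a.
by apply: cvg_pair; [exact: cvg_cst|exact: cvg_id].
Qed.

(** In a neighbourhood of a cluster point [p] of [y] there is first some [y i], then some [y k] with
    [k > i]. *)
Lemma no_homogeneous_sequence (T : topologicalType) (D : set (T * T))
    (y : nat -> T) :
  compact [set: T] -> closed D -> (forall i k, (i < k)%N -> D (y i, y k)) ->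
  exists p, D (p, p).
Proof.
move=> cT cD yD; have [p yp] := @sequence_cluster _ y cT.
exists p; apply: cD => B [[U V] /= [pU pV] UVB].
have [_ [[i _ <-] [Ui _]]] := yp 0 _ (filterI pU pV).
have [_ [[k _ <-] [_ Vk]]] := yp i.+1 _ (filterI pU pV).
exists (y (0 + i)%N, y (i.+1 + k)%N); split; last exact: UVB.
by apply: yD; rewrite add0n addSn ltnS leq_addr.
Qed.

Lemma max_omega_filter_principal (X : topologicalType) (F : set (set X))
    (K : (nat -> nat) -> set (X * X)) :
  compact [set: X] -> ordered_closed K ->
  (forall a b, (exists f, K f (a, b)) <-> a <> b) ->
  max_omega_filter F -> exists y, F [set y].
Proof.
move=> cX oK KE mF; have [Fo FI Fm] := mF.
apply: contrapT => /forallNP nF.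
pose Ky y g := [set a | K g (y, a)].
have oKy y : ordered_closed (Ky y) by exact: ordered_closed_section.
have /choice[h hP] y : exists f, F (core (Ky y) f).
  (* As [F] contains no singleton, no member lies inside [[set y]], so its complement is
     positive. *)
  have [||f fP] := @positive_branch _ F (~` [set y]) (fun a g => K g (y, a)) cX mF.
  - move=> S FS; apply: contrapT => yS; apply: (nF y).
    have Sy : S `<=` [set y].
      by move=> x Sx; apply: contrapT => xy; apply: yS; exists x.
    have [oS [x Sx]] := Fo _ FS.
    suff <- : S = [set y] by [].
    by apply/seteqP; split => // _ ->; rewrite -(Sy x Sx).
  - by move=> a /= ya; apply/KE => ay; apply: ya.
  exists f; apply: max_omega_filter_core => // n S /(fP n)[a [[_ [g gf Ka]] Sa]].
  by exists a; split => //; exists g.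
(* A second branching, on the functions [h y] themselves: for each [n], the points [y] with [h y]
   equal to [f] below [n] form a positive set. *)
have [||f fP] := @positive_branch _ F setT (fun y g => g = h y) cX mF.
- by move=> S FS; have [_ [x Sx]] := Fo _ FS; exists x.
- by move=> a _; exists (h a).
have /choice[pick pickP] (kS : nat * set X) :
    exists y, F kS.2 -> agree kS.1 (h y) f /\ kS.2 y.
  have [FS|nFS] := pselect (F kS.2).
    by have [y [[_ [g gf gE]] Sy]] := fP kS.1 _ FS; exists y; rewrite -gE.
  by have [_ [y _]] := Fo _ (max_omega_filterT mF); exists y.
pose fix S k := if k is n.+1
  then S n `&` core (Ky (pick (n, S n))) (h (pick (n, S n))) else setT.
have FS k : F (S k).
  by elim: k => [|k IH]; [exact: max_omega_filterT|exact: FI].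
pose y k := pick (k, S k).
have yh k : agree k (h (y k)) f by have [] := pickP (k, S k) (FS k).
have Sy k : S k (y k) by have [] := pickP (k, S k) (FS k).
have Sle i k : (i <= k)%N -> S k `<=` S i.
  by elim: k => [|k IH]; [rewrite leqn0 => /eqP ->|
    rewrite leq_eqVlt => /predU1P[->//|/IH ik] x [/ik]].
have /choice[G GP] (ik : nat * nat) : exists g, (ik.1 < ik.2)%N ->
    agree ik.2 g (h (y ik.1)) /\ K g (y ik.1, y ik.2).
  have [lt_ik|] := ltnP ik.1 ik.2; last by exists f.
  have [_ /(_ ik.2 I)[g gh Kg]] := Sle _ _ lt_ik _ (Sy ik.2).
  by exists g.
(* [g] bounds every [G (i, k)] with [i < k]: at [j >= k] by the double sum; at [j < k] the value is
   [h (y i) j], which the single sum bounds if [i <= j] and which is [f j] if [j < i]. *)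
pose g j := (f j + \sum_(i < j.+1) h (y i) j
  + \sum_(i < j.+1) \sum_(k < j.+1) G (nat_of_ord i, nat_of_ord k) j)%N.
have sum_ge (u : nat -> nat) j i : (i <= j)%N -> (u i <= \sum_(l < j.+1) u l)%N.
  by move=> ij; rewrite (bigD1 (Ordinal (ij : i < j.+1)%N))//= leq_addr.
have [||p] := @no_homogeneous_sequence _ (K g) y cX.
- by have [] := oK.
- move=> i k ik; have [Gh] := GP (i, k) ik.
  apply: (proj2 oK) => j; rewrite /g.
  have [kj|jk] := leqP k j.
    have ij : (i <= j)%N by rewrite (leq_trans _ kj)// ltnW.
    rewrite (leq_trans _ (leq_addl _ _))//.
    apply: leq_trans
      (sum_ge (fun i => \sum_(k < j.+1) G (i, nat_of_ord k) j)%N _ _ ij).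
    exact: (sum_ge (fun k => G (i, k) j)).
  rewrite (leq_trans _ (leq_addr _ _))// Gh//.
  have [ij|ji] := leqP i j; last by rewrite yh// leq_addr.
  rewrite (leq_trans _ (leq_addl _ _))//.
  exact: (sum_ge (fun i => h (y i) j)).
- by move=> Kpp; have /KE : exists f, K f (p, p) by exists g.
Qed.

(** For maximality: the image of each [S] in [F] is omega-closed, hence in the pushed filter, and if
    [C] meets this image, its preimage meets [S]. *)
Lemma max_omega_filter_image (T U : topologicalType) (f : T -> U)
    (F : set (set T)) :
  compact [set: T] -> hausdorff_space U -> continuous f ->
  max_omega_filter F ->
  max_omega_filter [set C | omega_closed C /\ F (f @^-1` C)].
Proof.
move=> cT hU cf mF; have [Fo FI Fm] := mF; split.
- by move=> S [oS /Fo[_ [x Sx]]]; split => //; exists (f x).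
- move=> S S' [oS FS] [oS' FS']; split; first exact: omega_closedI.
  by rewrite preimage_setI; exact: FI.
- move=> C oC CF; split => //; apply: Fm => [|S FS].
    exact: omega_closed_preimage.
  have [oS _] := Fo _ FS.
  have ofS : omega_closed (f @` S) by exact: omega_closed_image.
  have [|z [Cz [x Sx fxz]]] := CF (f @` S); last first.
    by exists x; split => //=; rewrite fxz.
  split => //; apply: max_omega_filterS FS _ _ => //.
    exact: omega_closed_preimage.
  exact: preimage_image.
Qed.


(** * Metrizability from countably many functions *)

Lemma compact_hausdorff_separating (R : realType) (X : topologicalType)
    (a b : X) :
  compact [set: X] -> hausdorff_space X -> a <> b ->
  exists h : X -> R,
    [/\ continuous h, forall x, h x \in `[0, 1]%R, h a = 0%R & h b = 1%R].
Proof.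
move=> cX hX ab.
have aX := hausdorff_accessible hX.
have := @normal_completely_regular R X (compact_normal hX cX) aX a [set b].
move=> /(_ (accessible_closed_set1 aX (x:=b)) ab) /(@uniform_separatorP X R).
move=> [h [ch h01 ha hb]]; exists h; split => //.
- by move=> x; apply: h01; exists x.
- by apply: ha; exists a.
- by apply: hb; exists b.
Qed.

Section sup_metric.
Local Open Scope ring_scope.
Context {R : realType} {X : choiceType} (u : nat -> X -> R).
Hypothesis u01 : forall n x, u n x \in `[0, 1].
Hypothesis u_sep : forall x y, (forall n, u n x = u n y) -> x = y.

(** The weights 1/(n+1) leave only finitely many terms above a given positive bound, so the distance
    is small wherever finitely many [u n] vary little. *)
Let D x y := range (fun n => `|u n x - u n y| / n.+1%:R).

Definition sup_dist x y : R := sup (D x y).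

Lemma sup_dist_ubound x y : has_ubound (D x y).
Proof.
exists 1 => _ [n _ <-]; rewrite ler_pdivrMr// mul1r.
rewrite (@le_trans _ _ 1)// ?ler1n// ler_norml.
move: (u01 n x) (u01 n y); rewrite !in_itv/=; lra.
Qed.

Lemma sup_dist_ge n x y : `|u n x - u n y| / n.+1%:R <= sup_dist x y.
Proof. by apply: ub_le_sup; [exact: sup_dist_ubound|exists n]. Qed.

Lemma sup_dist_le x y e :
  (forall n, `|u n x - u n y| / n.+1%:R <= e) -> sup_dist x y <= e.
Proof.
move=> ue; apply: ge_sup => [|_ [n _ <-]//].
by exists (`|u 0%N x - u 0%N y| / 1%:R); exists 0%N.
Qed.

Lemma sup_distxx x : sup_dist x x = 0.
Proof.
apply/eqP; rewrite eq_le; apply/andP; split.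
  by apply: sup_dist_le => n; rewrite subrr normr0 mul0r.
by apply: le_trans (sup_dist_ge 0 x x); rewrite mulr_ge0// invr_ge0.
Qed.

Lemma sup_dist_positivity x y : sup_dist x y = 0 -> x = y.
Proof.
move=> xy; apply: u_sep => n; have := sup_dist_ge n x y.
rewrite xy pmulr_lle0 ?invr_gt0// normr_le0 subr_eq0 => /eqP.
exact.
Qed.

Lemma sup_dist_sym x y : sup_dist x y = sup_dist y x.
Proof.
by congr (sup (image setT _)); apply/funext => n; rewrite distrC.
Qed.

Lemma sup_dist_triangle y x z : sup_dist x z <= sup_dist x y + sup_dist y z.
Proof.
apply: sup_dist_le => n.
rewrite (le_trans _ (lerD (sup_dist_ge n x y) (sup_dist_ge n y z)))//.
by rewrite -mulrDl ler_wpM2r ?invr_ge0// ler_distD.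
Qed.

Definition sup_metric_type : Type := X.

HB.instance Definition _ := Choice.on sup_metric_type.

HB.instance Definition _ := @isMetric.Build R sup_metric_type sup_dist
  sup_distxx sup_dist_positivity sup_dist_sym sup_dist_triangle.

Definition sup_metric : metricType R := sup_metric_type.
End sup_metric.


(** The identity onto the metric copy is a continuous bijection from a compact space to a Hausdorff
    one. *)
Lemma metrizable_separating_sequence (R : realType) (X : topologicalType)
    (u : nat -> X -> R) :
  compact [set: X] -> (forall n, continuous (u n)) ->
  (forall n x, u n x \in `[0, 1]%R) ->
  (forall x y, (forall n, u n x = u n y) -> x = y) ->
  metrizable R X.
Proof.
move=> cX cu u01 us.
pose M := sup_metric u01 us.
pose f : X -> M := id.
pose g : M -> X := id.
have cf : continuous f.
  move=> x; apply/metricType_numDomainType.cvgrPdist_lt => e e0.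
  (* Half of [e], because a supremum of terms below a bound may reach that bound. *)
  have e20 : (0 < e / 2)%R by rewrite divr_gt0.
  have [N _ HN] := near_infty_natSinv_lt (PosNum e20).
  have near_u n : \forall t \near x, (`|u n x - u n t| < e / 2)%R.
    by move: (cu n x) => /cvgrPdist_lt; apply.
  have : \forall t \near x, forall n, (n < N)%N -> (`|u n x - u n t| < e / 2)%R.
    elim: N {HN} => [|N IH]; first by near=> t.
    near=> t => n; rewrite ltnS leq_eqVlt => /predU1P[->|].
      by near: t; exact: near_u.
    by move: n; near: t.
  apply: filterS => t ut.
  apply: (@le_lt_trans _ _ (e / 2)%R); last first.
    by rewrite ltr_pdivrMr// ltr_pMr// ltr1n.
  apply: sup_dist_le => n; have [nN|Nn] := ltnP n N.
    rewrite (le_trans _ (ltW (ut _ nN)))// ler_pdivrMr//.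
    by rewrite ler_peMr// ler1n.
  rewrite (le_trans _ (ltW (HN _ Nn)))// ler_pdivrMr// mulVf ?pnatr_eq0//.
  rewrite ler_norml; move: (u01 n x) (u01 n t); rewrite !in_itv/=; lra.
exists M, f, g; split => //.
apply/continuous_closedP => A cA.
apply: compact_closed; first exact: (@metric_hausdorff R M).
have -> : g @^-1` A = f @` A by apply/seteqP; split => [x Ax|_ [x Ax <-]//]; exists x.
apply: continuous_compact; first exact: continuous_subspaceT.
exact: subclosed_compact cA cX _.
Unshelve. all: by end_near. Qed.

(** Near each point of the compact set [C n] one function tells the two coordinates apart, so
    finitely many suffice on all of [C n], and countably many for all [n]. *)
Lemma metrizable_offdiag_cover (R : realType) (X : topologicalType)
    (C : nat -> set (X * X)) :
  compact [set: X] -> hausdorff_space X -> (forall n, closed (C n)) ->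
  \bigcup_n C n = ~` diagonal -> metrizable R X.
Proof.
move=> cX hX cC CE.
have cXX : compact [set: X * X] by rewrite -setXTT; exact: compact_setX.
have /choice[h hP] (p : X * X) : exists h : X -> R, [/\ continuous h,
    forall x, h x \in `[0, 1]%R & p.1 <> p.2 -> h p.1 <> h p.2].
  have [pp|pp] := pselect (p.1 = p.2).
    exists (fun=> 0%R); split => //; first by move=> x; exact: cvg_cst.
    by move=> x; rewrite in_itv/= lexx ler01.
  have [h [ch h01 h0 h1]] := compact_hausdorff_separating R cX hX pp.
  by exists h; split => // _; rewrite h0 h1 => /esym/eqP; rewrite oner_eq0.
have /choice[s sP] n : exists s : seq (X * X),
    forall z, C n z -> exists2 p, p \in s & h p z.1 <> h p z.2.
  have cCn : compact (C n) by exact: subclosed_compact (cC n) cXX _.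
  (* With finite sequences directed by inclusion, the near-covering form of compactness yields a
     finite subcover. *)
  pose F := filter_from [set: seq (X * X)]
    (fun s => [set t : seq (X * X) | {subset s <= t}]).
  have FF : Filter F.
    apply: filter_from_filter; first by exists [::].
    move=> s t _ _; exists (s ++ t) => // r str; split => p ps; apply: str;
      by rewrite mem_cat ps ?orbT.
  have := (compact_near_coveringP _).1 cCn _ F
    (fun s z => exists2 p, p \in s & h p z.1 <> h p z.2) FF.
  case=> [z Cz|s _ sC]; last by exists s => z; apply: sC.
  have [ch _ hz] := hP z.
  have zz : z.1 <> z.2 by move=> zz; have : (~` diagonal) z by rewrite -CE; exists n.
  exists ([set w | h z w.1 - h z w.2 != 0]%R, [set t | z \in t]) => /=.
    split; last by exists [:: z] => // t; apply; rewrite inE.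
    have : (fun w : X * X => h z w.1 - h z w.2)%R @ z --> (h z z.1 - h z z.2)%R.
      by apply: cvgB; apply: continuous_cvg;
        [exact: ch|exact: cvg_fst|exact: ch|exact: cvg_snd].
    move=> /(_ [set r | r != 0%R]); apply.
    apply: open_nbhs_nbhs; split; first exact: open_neq.
    by rewrite /= subr_eq0; apply/eqP/hz.
  move=> [w t] [/= hw zt]; exists z => //.
  by move=> hww; rewrite hww subrr eqxx in hw.
pose u m := if unpickle m is Some (n, i)
  then nth (fun=> 0%R) [seq h p | p <- s n] i else fun=> 0%R.
have uP (Q : (X -> R) -> Prop) :
    Q (fun=> 0%R) -> (forall p, Q (h p)) -> forall m, Q (u m).
  move=> Q0 Qh m; rewrite /u; case: unpickle => [[n i]|//].
  have [im|im] := ltnP i (size (s n)); last by rewrite nth_default// size_map.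
  case: (s n) im => // p0 r im; rewrite (nth_map p0)//.
apply: (@metrizable_separating_sequence R X u) => //.
- apply: (uP (fun f => continuous f)) => [x|p]; first exact: cvg_cst.
  by have [] := hP p.
- apply: (uP (fun f => forall x, f x \in `[0, 1]%R)) => [x|p].
    by rewrite in_itv/= lexx ler01.
  by have [] := hP p.
- move=> x y uxy; apply: contrapT => xy.
  have : (~` diagonal) (x, y) by [].
  rewrite -CE => -[n _ /sP[p ps]]; apply => /=.
  have := uxy (pickle (n, index p (s n))); rewrite /u pickleK.
  by rewrite (nth_map p) ?index_mem// nth_index.
Qed.

(** * Closures of cylinders away from the diagonal *)

Lemma closure_cyl_offdiag (R : realType) (X : topologicalType)
    (K : (nat -> nat) -> set (X * X)) f :
  compact [set: X] -> hausdorff_space X -> ordered_closed K ->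
  (forall a b, (exists f, K f (a, b)) <-> a <> b) ->
  exists n, closure (cyl K f n) `<=` ~` diagonal.
Proof.
move=> cX hX oK KE; apply: contrapT => /forallNP nf.
have cXX : compact [set: X * X] by rewrite -setXTT; exact: compact_setX.
(* Supersets [G] make [B] stable under intersection: the closure of the intersection of [U] and [U']
   lies in both closures but need not be their intersection. *)
pose B := [set G | omega_closed G /\ exists U : set (X * X),
  [/\ open U, diagonal `<=` U & core K f `&` closure U `<=` G]].
have ocU (U : set (X * X)) : omega_closed (core K f `&` closure U).
  apply: omega_closedI; first exact: core_omega_closed.
  by apply: closed_omega_closed; exact: closed_closure.
have [|||F [BF mF]] := @max_omega_filter_exists _ B.
- exists (core K f `&` closure setT); split; first exact: ocU.
  by exists setT; split => //; exact: openT.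
- move=> S [oS [U [oU dU US]]]; split => //.
  have [|n|z /US Sz] := @core_meets _ K f (closure U) cXX oK; last by exists z.
    by apply: closed_omega_closed; exact: closed_closure.
  have [z [cz dz]] : closure (cyl K f n) `&` diagonal !=set0.
    apply: contrapT => nz; apply: (nf n) => z cz dz; apply: nz; by exists z.
  have [w [Aw Uw]] := cz U (open_nbhs_nbhs (conj oU (dU _ dz))).
  by exists w; split => //; exact: subset_closure.
- move=> S S' [oS [U [oU dU US]]] [oS' [U' [oU' dU' US']]].
  split; first exact: omega_closedI.
  exists (U `&` U'); split; first exact: openI.
    by move=> z dz; split; [exact: dU|exact: dU'].
  move=> z [Kz cz]; split; [apply: US|apply: US']; split => //;
    by apply: closureS cz => ? [].
have [Fo FI Fm] := mF.
have cf : continuous (@fst X X) by move=> z; exact: cvg_fst.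
have cs : continuous (@snd X X) by move=> z; exact: cvg_snd.
have [a [_ Fa]] := max_omega_filter_principal cX oK KE
  (max_omega_filter_image cXX hX cf mF).
have [b [_ Fb]] := max_omega_filter_principal cX oK KE
  (max_omega_filter_image cXX hX cs mF).
have Fab : F [set (a, b)].
  suff <- : fst @^-1` [set a] `&` snd @^-1` [set b] = [set (a, b)] by exact: FI.
  by apply/seteqP; split => [[x y] [/= -> ->]//|_ ->].
have Kab U : open U -> diagonal `<=` U -> core K f (a, b) /\ closure U (a, b).
  move=> oU dU.
  have FU : F (core K f `&` closure U).
    by apply: BF; split; [exact: ocU|exists U; split].
  by have [_ [z [[Kz cz] <-]]] := Fo _ (FI _ _ FU Fab).
have [g _ Kg] := (Kab setT openT (fun _ _ => I)).1 0 I.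
have ab : a <> b by apply/KE; exists g.
have [h [ch _ ha hb]] := compact_hausdorff_separating R cX hX ab.
(* [u] vanishes on the diagonal and is 1 at [(a, b)], so the closure of the open set [u < 1/2]
   misses [(a, b)]. *)
pose u (w : X * X) : R := (h w.2 - h w.1)%R.
have cu : continuous u.
  by move=> z; apply: cvgB; apply: continuous_cvg;
    [exact: ch|exact: cvg_snd|exact: ch|exact: cvg_fst].
have [||_ cU] := Kab (u @^-1` [set r | (r < 2^-1)%R]).
- by apply: open_comp => [? _|]; [exact: cu|exact: open_lt].
- by move=> z zE; rewrite /preimage /u /= (zE : z.1 = z.2) subrr invr_gt0.
have : (u (a, b) <= 2^-1)%R.
  apply: (closure_sub_closed (closed_preimage cu (@closed_le _ (2^-1 : R)%R)) _ cU).
  by move=> z /ltW.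
by rewrite /u /= ha hb subr0 leNgt invf_lt1// ltr1n.
Qed.

(** * Boxes in the Baire space and the reindexed cover *)

Lemma compact_baire_box (f : nat -> nat) :
  compact [set g : baire | forall n, (g n <= f n)%N].
Proof.
apply: (@tychonoff nat (fun=> nat) (fun n => [set k | (k <= f n)%N])) => n.
by apply: finite_compact; apply: (sub_finite_set _ (finite_II (f n).+1)) => k.
Qed.

(** Each coordinate is locally constant, hence bounded on a compact set. Boxes are thus cofinal
    among compact sets, which allows indexing by functions. *)
Lemma compact_baire_bounded (L : set baire) :
  compact L -> exists f : nat -> nat, L `<=` [set g | forall n, (g n <= f n)%N].
Proof.
move=> cL; have /choice[f fP] n : exists m, forall g, L g -> (g n <= m)%N.
  have := (compact_near_coveringP _).1 cL _ \oo
    (fun m (g : baire) => (g n <= m)%N) _.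
  case=> [g Lg|m _ Lm]; last by exists m => g /(Lm m (leqnn m)).
  exists ([set g' : baire | g' n = g n], [set m | (g n <= m)%N]) => /=.
    split; last by exists (g n).
    have : nbhs (g n) [set g n] by rewrite nbhs_principalE.
    exact: (@proj_continuous nat (fun=> nat) n g).
  by move=> [g' m] /= [-> ].
by exists f => g Lg n; exact: fP.
Qed.

Lemma hausdorff_setX (X Y : topologicalType) :
  hausdorff_space X -> hausdorff_space Y -> hausdorff_space (X * Y)%type.
Proof.
move=> hX hY [a b] [c d] cl; congr pair.
  apply: hX => U V aU cV.
  have [[x y] [/= Ux Vx]] := cl _ _ (cvg_fst aU) (cvg_fst cV); by exists x.
apply: hY => U V bU dV.
by have [[x y] [/= Uy Vy]] := cl _ _ (cvg_snd bU) (cvg_snd dV); exists y.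
Qed.

Lemma P_diagonal_ordered (X : topologicalType) :
  hausdorff_space X -> P_diagonal X ->
  exists K : (nat -> nat) -> set (X * X), ordered_closed K /\
    forall a b, (exists f, K f (a, b)) <-> a <> b.
Proof.
move=> hX [C [cC CE mC]].
pose box f := [set g : baire | forall n, (g n <= f n)%N].
exists (fun f => set_val @` C (box f)); split.
  split=> [f|f g fg].
    apply: compact_closed; first exact: hausdorff_setX.
    apply: continuous_compact; last by apply: cC; exact: compact_baire_box.
    apply: continuous_subspaceT; exact: initial_continuous.
  apply: image_subset; apply: mC; [exact: compact_baire_box|exact: compact_baire_box|].
  by move=> k kf n; rewrite (leq_trans (kf n)).
move=> a b; split.
  move=> [f [z _ zab]] ab; have : (~` diagonal) (set_val z) by exact: set_valP.
  by rewrite zab.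
move=> ab.
have abP : (a, b) \in ~` @diagonal X by rewrite inE.
have : [set: set_type (~` @diagonal X)] (exist _ (a, b) abP) by [].
rewrite -CE => -[L cL CL]; have [f Lf] := compact_baire_bounded cL.
exists f; exists (exist _ (a, b) abP) => //.
by apply: mC CL => //; exact: compact_baire_box.
Qed.

Theorem theorem8 (R : realType) (X : topologicalType)
    (hcpt : compact [set: X]) (hT2 : hausdorff_space X)
    (hdiag : P_diagonal X) :
  metrizable R X.
Proof.
have [K [oK KE]] := P_diagonal_ordered hT2 hdiag.
(* Indexing the cylinders by finite sequences makes them countably many; in [C], closures that meet
   the diagonal are replaced by [set0]. *)
pose A (s : seq nat) := [set z | exists2 g, mkseq g (size s) = s & K g z].
pose C n := if unpickle n is Some s then
  if `[< closure (A s) `<=` ~` diagonal >] then closure (A s) else set0 else set0.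
apply: (@metrizable_offdiag_cover R X C hcpt hT2) => [n|].
  rewrite /C; case: unpickle => [s|]; last exact: closed0.
  by case: ifP => _; [exact: closed_closure|exact: closed0].
apply/seteqP; split => [z [n _]|[a b] ab].
  rewrite /C; case: unpickle => [s|//].
  by case: asboolP => // sA /sA.
have [f Kf] : exists f, K f (a, b) by apply/KE.
have [n fn] := closure_cyl_offdiag R f hcpt hT2 oK KE.
have AE : A (mkseq f n) `<=` cyl K f n.
  move=> z [g]; rewrite size_mkseq => gf Kg; exists g => // i ni.
  by move/(congr1 (fun s => nth 0 s i)) : gf; rewrite !nth_mkseq.
exists (pickle (mkseq f n)) => //; rewrite /C pickleK.
case: asboolP => [_|[]]; last exact: subset_trans (closureS AE) fn.
by apply: subset_closure; exists f; rewrite ?size_mkseq.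
Qed.
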